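(* Fix $\delta_{\mathrm{TV}}\in[0,1)$. There are constants $c_{\delta_{\mathrm{TV}}}>0$ and $\kappa_{\delta_{\mathrm{TV}}}<\infty$, independent of $d$, such that for all $d\ge2$ and all $\kappa\ge\kappa_{\delta_{\mathrm{TV}}}$ the following holds: if a finite-bit sampler, with arbitrary common randomness, uses a transcript of at most $Q$ bits and outputs $\widehat Y$ such that \[ \sup_{\pi\in\mathcal C_d(\kappa)} d_{\mathrm{TV}}\bigl(\mathcal L(\widehat Y),\pi\bigr)\le\delta_{\mathrm{TV}}, \] then $Q\ge c_{\delta_{\mathrm{TV}}}\,d\log_2\kappa$.
   Context: $\mathcal C_d(\kappa)=\{\mathcal N(0,\Sigma):\frac1\kappa I\preceq\Sigma\preceq I\}$ on $\mathbb R^d$. A finite-bit sampler with common randomness and transcript of at most $Q$ bits: when the target is $\pi\in\mathcal C_d(\kappa)$, there is common randomness $Z$ independent of $\pi$, a transcript $T=T(\pi,Z)$ taking values in a fixed set of size at most $2^Q$ (the only information about $\pi$ available to the sampler, e.g. the bits returned by an oracle), and output $\widehat Y=\widehat Y(T,Z)$; $\mathcal L(\widehat Y)$ is the law of $\widehat Y$ when the target is $\pi$, and $d_{\mathrm{TV}}$ is total variation distance. *)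

(* Defs.v *)
From HB Require Import structures.
From mathcomp Require Import all_boot all_order all_algebra.
From mathcomp Require Import all_classical all_reals all_analysis.

Set Implicit Arguments.
Unset Strict Implicit.
Unset Printing Implicit Defensive.

Import Order.TTheory GRing.Theory Num.Theory.

Local Open Scope classical_set_scope.
Local Open Scope ring_scope.

(* R^n with the product sigma-algebra, which is its Borel sigma-algebra. *)
Notation Rn R n := (n.-tuple (measurableTypeR R)).

Definition tuple_cons {R : realType} (n : nat)
    (p : measurableTypeR R * Rn R n) : Rn R n.+1 :=
  [tuple of p.1 :: p.2].

Lemma measurable_tuple_cons {R : realType} (n : nat) :
  measurable_fun [set: measurableTypeR R * Rn R n] (@tuple_cons R n).
Proof. exact: measurable_cons. Qed.

HB.instance Definition _ (R : realType) (n : nat) :=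
  isMeasurableFun.Build _ _ _ _ (@tuple_cons R n) (@measurable_tuple_cons R n).

(* The law of n independent standard normal variables. *)
Fixpoint std_gaussian (R : realType) (n : nat) : probability (Rn R n) R :=
  match n with
  | 0 => \d_([tuple] : Rn R 0)
  | m.+1 => distribution
      ((normal_prob (0 : R) 1 : probability (measurableTypeR R) R)
         \x std_gaussian R m)%E
      (@tuple_cons R m)
  end.

Definition mx_apply {R : realType} (n : nat) (A : 'M[R]_n) (x : Rn R n) :
    Rn R n :=
  [tuple \sum_(j < n) A i j * tnth x j | i < n].

(* pi is N(0, Sigma): the law of A G, where G is standard Gaussian and
   A A^T = Sigma.  Probabilities are compared on measurable sets only, as the
   values of a library measure on other sets are irrelevant. *)
Definition is_gaussian {R : realType} (n : nat) (Sigma : 'M[R]_n)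
    (pi : probability (Rn R n) R) : Prop :=
  exists2 A : 'M[R]_n, A *m A^T = Sigma &
    forall B : set (Rn R n), measurable B ->
      pi B = pushforward (std_gaussian R n) (mx_apply A) B.

Definition psdmx {R : realType} (n : nat) (M : 'M[R]_n) : Prop :=
  M^T = M /\ forall u : 'rV[R]_n, 0 <= (u *m M *m u^T) 0 0.

Definition loewner_le {R : realType} (n : nat) (A B : 'M[R]_n) : Prop :=
  psdmx (B - A).

Definition gaussian_class {R : realType} (n : nat) (kappa : R) :
    set (probability (Rn R n) R) :=
  [set pi | exists Sigma : 'M[R]_n,
     [/\ loewner_le (kappa^-1)%:M Sigma, loewner_le Sigma 1%:M
       & is_gaussian Sigma pi]].

Definition tv_dist {d : measure_display} {T : measurableType d} {R : realType}
    (mu nu : set T -> \bar R) : \bar R :=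
  ereal_sup [set `|mu A - nu A|%E | A in (measurable : set (set T))].

(* The randomness is the sample space (seed, seed_law), which does not depend on
   the target; the reconstruction sees the target only through the transcript.
   The number of bits Q is real, so that log2 of the number of transcripts is an
   admissible value. *)
Record finite_bit_sampler (R : realType) (n : nat)
    (C : set (probability (Rn R n) R)) (Q : R) := FiniteBitSampler {
  seed_display : measure_display ;
  seed : measurableType seed_display ;
  seed_law : probability seed R ;
  message : finType ;
  card_message : #|message|%:R <= 2 `^ Q ;
  transcript : probability (Rn R n) R -> seed -> message ;
  measurable_transcript : forall pi, C pi ->
    forall t : message, measurable [set z | transcript pi z = t] ;
  reconstruct : message -> seed -> Rn R n ;
  measurable_reconstruct : forall t : message,
    measurable_fun [set: seed] (reconstruct t) }.

Arguments transcript {R n C Q} S pi z : rename.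
Arguments reconstruct {R n C Q} S t z : rename.

Definition output_law {R : realType} (n : nat)
    (C : set (probability (Rn R n) R)) (Q : R) (S : finite_bit_sampler C Q)
    (pi : probability (Rn R n) R) : set (Rn R n) -> \bar R :=
  pushforward (seed_law S) (fun z => reconstruct S (transcript S pi z) z).

(* Main.v *)
(* Fix the common randomness: the output then takes at most 2^Q values.  So if
   targets pi_i in the class put mass at least eta on sets A_i such that every
   point lies in at most L of the A_i, summing P(output in A_i) >= eta - delta
   over the N targets gives N (eta - delta) <= 2^Q L.
   The targets are products of planar Gaussians on the m = n./2 blocks of
   coordinates (2l, 2l+1), each concentrated near a line of slope k / q^2 through
   the origin; the angular width of order 1 / sqrt kappa allows q of order
   kappa^(1/8), with lots of room.  The slopes are indexed by all functions
   f : 'I_m -> 'I_(q^2), and A_f requires only that half of the blocks lie in the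
   expected cone.  By Markov's inequality A_f then has large mass uniformly in
   the dimension, and a point lies in at most (2q)^m of the q^(2m) sets. *)
Require Import Defs.
From HB Require Import structures.
From mathcomp Require Import all_boot all_order all_algebra.
From mathcomp Require Import all_classical all_reals all_analysis.
From mathcomp Require Import measurable_realfun.
From mathcomp Require Import lra ring zify.
Import Order.TTheory GRing.Theory Num.Theory.
Local Open Scope classical_set_scope.
Local Open Scope ring_scope.

(** * Sums of indicators *)

Lemma measurable_sum_indic (R : realType) d (T : measurableType d)
    (I : finType) (E : I -> set T) :
  (forall i, measurable (E i)) ->
  measurable_fun [set: T] (fun x => \sum_i (\1_(E i) x : R)%:E).
Proof.
move=> mE; apply: emeasurable_sum => i.
by apply/measurable_EFinP; exact: measurable_indic.
Qed.

Lemma integral_sum_indic (R : realType) d (T : measurableType d)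
    (mu : {measure set T -> \bar R}) (I : finType) (E : I -> set T) :
  (forall i, measurable (E i)) ->
  (\int[mu]_x (\sum_i (\1_(E i) x)%:E) = \sum_i mu (E i))%E.
Proof.
move=> mE; rewrite ge0_integral_sum//.
- by apply: eq_bigr => i _; rewrite integral_indic// setIT.
- by move=> i; apply/measurable_EFinP; exact: measurable_indic.
Qed.

Lemma sum_probability_le (R : realType) d (T : measurableType d)
    (P : probability T R) (I : finType) (E : I -> set T) (L : R) :
  (forall i, measurable (E i)) -> (forall x, \sum_i \1_(E i) x <= L) ->
  (\sum_i P (E i) <= L%:E)%E.
Proof.
move=> mE leL; rewrite -integral_sum_indic//.
have -> : L%:E = (\int[P]_x (cst L%:E x))%E.
  by rewrite integral_cst// -[LHS]mule1 -(@probability_setT _ _ _ P).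
(* A sample point gives [0 <= L]; without one, both integrals vanish. *)
have [->|/set0P[x0 _]] := eqVneq [set: T] set0.
  by rewrite !integral_set0.
have L0 : 0 <= L by rewrite (le_trans _ (leL x0))// sumr_ge0.
apply: ge0_le_integral => //.
- by move=> x _; apply: sume_ge0 => i _; rewrite lee_fin.
- exact: measurable_sum_indic.
- by move=> x _; rewrite sumEFin lee_fin leL.
Qed.

(** Markov's inequality for the number of sets [E i] containing a point; it serves to count steep
    blocks. *)
Lemma markov_sum_indic (R : realType) d (T : measurableType d)
    (mu : {measure set T -> \bar R}) (I : finType) (E : I -> set T) (G : set T)
    (L : R) :
  (forall i, measurable (E i)) -> measurable G -> 0 <= L ->
  (forall x, G x -> L <= \sum_i \1_(E i) x) ->
  (L%:E * mu G <= \sum_i mu (E i))%E.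
Proof.
move=> mE mG L0 leL; rewrite -integral_sum_indic//.
rewrite -(integral_cst mu mG).
apply: (@le_trans _ _ (\int[mu]_(x in G) (\sum_i (\1_(E i) x)%:E))%E).
- apply: ge0_le_integral => //.
  + by apply: measurable_funTS; exact: measurable_sum_indic.
  + by move=> x Gx; rewrite sumEFin lee_fin leL.
- apply: ge0_subset_integral => //.
  + exact: measurable_sum_indic.
  + by move=> x _; apply: sume_ge0 => i _; rewrite lee_fin.
Qed.

(** * Pairs of coordinates of a standard Gaussian vector *)

Local Notation gauss R := (normal_prob (0 : R) 1 : probability (measurableTypeR R) R).

Lemma measurable_tnth_pair (R : realType) n (i j : 'I_n) :
  measurable_fun [set: Rn R n]
    (fun x => (tnth x i, tnth x j) : measurableTypeR R * measurableTypeR R).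
Proof.
by apply: measurable_fun_pair; exact: measurable_tnth.
Qed.

Lemma std_gaussian_marginal_head (R : realType) n (i : 'I_n.+1)
    (E : set (measurableTypeR R)) : i = 0%N :> nat -> measurable E ->
  std_gaussian R n.+1 [set x | E (tnth x i)] = normal_prob (0 : R) 1 E.
Proof.
move=> i0 mE; have -> : i = ord0 by apply: val_inj.
rewrite /= /distribution /pushforward /=.
have -> : tuple_cons (n:=n) @^-1` [set x | E (tnth x ord0)] = E `*` [set: Rn R n].
  by apply/seteqP; split => -[a y] /=; rewrite tnth0 => //= -[].
rewrite product_measure1E//.
transitivity (normal_prob (0 : R) 1 E * 1)%E; last by rewrite mule1.
by congr (_ * _)%E; exact: probability_setT.
Qed.

(** Consecutive indices suit the recursion of [std_gaussian]: a pair away from the head is a pair of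
    the tail, and a pair at the head is handled by slicing along its first coordinate. *)
Lemma std_gaussian_marginal_pair (R : realType) n (i j : 'I_n)
    (D : set (measurableTypeR R * measurableTypeR R)) :
  j = i.+1 :> nat -> measurable D ->
  std_gaussian R n [set x | D (tnth x i, tnth x j)] =
  (gauss R \x gauss R)%E D.
Proof.
elim: n i j => [[]//|n IH] i j ij mD.
rewrite /= /distribution /pushforward /=.
have [i0|i0] := posnP i.
  have n0 : (0 < n)%N by have := ltn_ord j; rewrite ij i0.
  case: n i j ij IH n0 i0 => // n i j ij _ _ i0.
  rewrite /product_measure1; apply: eq_integral => a _ /=.
  pose k : 'I_n.+1 := ord0.
  rewrite -(@std_gaussian_marginal_head R n k)//; last exact: measurable_xsection.
  congr (std_gaussian R n.+1 _).
  have -> : i = ord0 by apply: val_inj.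
  have -> : j = lift ord0 k by apply: val_inj; rewrite /= ij i0.
  by apply/seteqP; split => y; rewrite /xsection/= !inE /= tnth0 tnthS.
have in' : (i.-1 < n)%N by have := ltn_ord i; rewrite -{1}(prednK i0).
have jn' : (i < n)%N by have := ltn_ord j; rewrite ij.
have Ei : i = lift ord0 (Ordinal in') by apply: val_inj; rewrite /= /bump /= add1n prednK.
have Ej : j = lift ord0 (Ordinal jn') by apply: val_inj; rewrite /= ij.
rewrite -(IH (Ordinal in') (Ordinal jn'))//=; last by rewrite prednK.
set F := [set x | D (tnth x (Ordinal in'), _)].
have mF : measurable F.
  rewrite -[F]setTI; exact: (measurable_tnth_pair _ _ _ _ measurableT _ mD).
have -> : tuple_cons (n:=n) @^-1` [set x | D (tnth x i, tnth x j)] =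
   [set: measurableTypeR R] `*` F.
  by apply/seteqP; split => -[a y] /=; rewrite Ei Ej !tnthS //= => -[].
rewrite product_measure1E//.
transitivity (1 * std_gaussian R n F)%E; last by rewrite mul1e.
by congr (_ * _)%E; exact: (@probability_setT _ _ _ (gauss R)).
Qed.

Lemma normal_prob_set1 (R : realType) (a : R) : normal_prob (0 : R) 1 [set a] = 0%E.
Proof.
have /null_content_dominatesP := normal_prob_dominates (0 : R) 1.
by apply => //; exact: lebesgue_measure_set1.
Qed.

(** The bad event for one block before shearing: outside it, the sheared point falls in its cone
    once [kappa] is large enough. *)
Definition steep (R : realType) (s : R) : set (measurableTypeR R * measurableTypeR R) :=
  [set x | s * `|x.1| <= `|x.2|].

Lemma measurable_steep (R : realType) (s : R) : measurable (steep R s).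
Proof.
have m := @measurable_fun_ler _ (measurableTypeR R * measurableTypeR R)%type R setT
  (fun x => s * `|x.1|) (fun x => `|x.2|).
rewrite -[steep R s]setTI; apply: m => //.
- by apply: measurable_funM => //; apply: measurableT_comp => //; exact: measurable_fst.
- by apply: measurableT_comp => //; exact: measurable_snd.
Qed.

(* The intersection over s of the sets steep s is the null line x.1 = 0. *)
Lemma gaussian_steep_small (R : realType) (e : R) : 0 < e ->
  exists2 s : R, 1 <= s & ((gauss R \x gauss R) (steep R s) <= e%:E)%E.
Proof.
move=> e0; set mu := (_ \x _)%E.
pose F n := steep R n.+1%:R.
have mF n : measurable (F n) by exact: measurable_steep.
have mI : measurable (\bigcap_n F n) by exact: bigcapT_measurable.
have decF : {homo F : n m / (n <= m)%N >-> (m <= n)%O}.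
  move=> n m nm; apply/subsetPset => x; apply: le_trans.
  by rewrite ler_wpM2r// ler_nat.
have F0 : (mu (F 0%N) < +oo)%E.
  by apply: (@le_lt_trans _ _ 1%E); [exact: probability_le1|exact: ltry].
have I0 : mu (\bigcap_n F n) = 0%E.
  apply/eqP; rewrite eq_le measure_ge0 andbT.
  apply: (@le_trans _ _ (mu ([set 0] `*` [set: measurableTypeR R]))).
    apply: le_measure; rewrite ?inE//; first exact: measurableX.
    move=> [x y] /= xy; split => //=; apply/eqP; apply/negPn/negP => x0.
    (* For nonzero [x], this index gives a slope exceeding [|y| / |x|]. *)
    have := xy (Num.trunc (`|y| / `|x|)) I.
    by rewrite /F /steep /= leNgt -ltr_pdivrMr ?normr_gt0// truncnS_gt.
  rewrite [mu _]product_measure1E// -[leRHS](mul0e 1%E).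
  by rewrite le_eqVlt; apply/orP; left; apply/eqP; congr (_ * _)%E;
    [exact: normal_prob_set1|exact: probability_setT].
have : (mu \o F) x @[x --> \oo] --> 0%E.
  by rewrite -I0; exact: nonincreasing_cvg_mu.
move=> /(_ [set y | (y < e%:E)%E]) [].
  by apply: open_nbhs_nbhs; split; [exact: open_ereal_lt_ereal|rewrite /= lte_fin].
move=> N _ /(_ N (leqnn N)) /= h; exists N.+1%:R; first by rewrite ler1n.
exact: ltW.
Qed.

(** * Gaussians sheared along pairs of coordinates *)

(** Indices in [nat] allow neighbours such as [k.+1] without range proofs; the value 0 completes an
    unpaired last coordinate to a pair. *)
Definition zero_ext (R : realType) n (f : 'I_n -> R) (k : nat) : R :=
  oapp f 0 (insub k).

Lemma zero_ext_ord (R : realType) n (f : 'I_n -> R) (i : 'I_n) :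
  zero_ext R n f i = f i.
Proof. by rewrite /zero_ext valK. Qed.

Lemma zero_ext_out (R : realType) n (f : 'I_n -> R) k :
  (n <= k)%N -> zero_ext R n f k = 0.
Proof. by move=> nk; rewrite /zero_ext insubN// -leqNgt. Qed.

Lemma sum_ord_delta (R : realType) n (F : nat -> R) k :
  ((n <= k)%N -> F k = 0) -> \sum_(i < n) (k == i)%:R * F i = F k.
Proof.
case: (ltnP k n) => [kn _|nk /(_ isT) ->].
  rewrite (bigD1 (Ordinal kn))//= eqxx mul1r big1 ?addr0// => i ik.
  by rewrite [k == i](_ : _ = false) ?mul0r//; apply/negbTE; rewrite eq_sym.
rewrite big1// => i _; rewrite [k == i](_ : _ = false) ?mul0r//.
by apply/negbTE; rewrite gtn_eqF// (leq_trans _ nk).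
Qed.

(** Padding with zeros up to [n.*2] terms completes every pair, whatever the parity of [n]. *)
Lemma sum_ord_pairs (R : realType) n (G : nat -> R) :
  (forall k, (n <= k)%N -> G k = 0) ->
  \sum_(i < n) G i = \sum_(l < n) (G l.*2 + G l.*2.+1).
Proof.
move=> G0.
have -> : \sum_(i < n) G i = \sum_(i < n.*2) G i.
  rewrite -(big_mkord predT) -(big_mkord predT G).
  rewrite [RHS](@big_cat_nat _ _ _ n)//= -?addnn ?leq_addl//.
  rewrite [X in _ + X]big_nat_cond [X in _ + X]big1 ?addr0// => i.
  by rewrite andbT => /andP[/G0].
elim: n {G0} => [|n IH]; first by rewrite !big_ord0.
by rewrite doubleS 3!big_ord_recr /= IH addrA.
Qed.

(* Acts on each pair of coordinates (2l, 2l+1) as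
   (x, y) |-> (x / 2, b l * x / 2 + w * y), and halves a last unpaired one. *)
Definition shear_mx (R : realType) n (w : R) (b : nat -> R) : 'M[R]_n :=
  \matrix_(i, j) if odd i then b i./2 / 2 * (j.+1 == i)%:R + w * (j == i)%:R
                 else 2^-1 * (j == i)%:R.

(** An odd column has only its diagonal entry; in an even column [j], row [j.+1] adds the shear
    coefficient. *)
Lemma mul_shear_mx (R : realType) n w b (u : 'rV[R]_n) (j : 'I_n) :
  let U := zero_ext R n (u 0) in
  (u *m shear_mx R n w b) 0 j =
    if odd j then w * U j else (U j + b j./2 * U j.+1) / 2.
Proof.
move=> U; rewrite mxE.
under eq_bigr => i _ do rewrite mxE -[u 0 i](zero_ext_ord _ _ (u 0)) -/U.
have U0 k : (n <= k)%N -> U k = 0 by exact: zero_ext_out.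
case: ifPn => oj.
  rewrite -(sum_ord_delta R n (fun k => w * U k) j); last first.
    by move=> /U0 ->; rewrite mulr0.
  apply: eq_bigr => i _; rewrite val_eqE; case: ifPn => oi.
    have -> : (j.+1 == i) = false by apply/negbTE/eqP => ji; move: oi; rewrite -ji /= oj.
    by rewrite mulr0n; ring.
  have -> : (j == i) = false by apply/negbTE/eqP => ji; move: oi; rewrite -ji oj.
  by rewrite mulr0n; ring.
rewrite -[RHS]/((fun k => (U k + b j./2 * U j.+1) / 2) j).
have -> : (U j + b j./2 * U j.+1) / 2 =
   \sum_(i < n) (j == i :> nat)%:R * ((fun k => U k / 2) i) +
   \sum_(i < n) (j.+1 == i :> nat)%:R * ((fun k => b k./2 * U k / 2) i).
  rewrite (sum_ord_delta R n (fun k => U k / 2)); last first.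
    by move=> /U0 ->; rewrite mul0r.
  rewrite (sum_ord_delta R n (fun k => b k./2 * U k / 2)); last first.
    by move=> /U0 ->; rewrite mulr0 mul0r.
  by rewrite /= uphalf_half (negbTE oj) add0n; ring.
rewrite -big_split /=; apply: eq_bigr => i _; rewrite val_eqE.
case: ifPn => oi.
  have -> : (j == i) = false by apply/negbTE/eqP => ji; move: oj; rewrite ji oi.
  by rewrite !mulr0n; ring.
have -> : (j.+1 == i) = false by apply/negbTE/eqP => ji; move: oi; rewrite -ji /= oj.
by rewrite mulr0n; ring.
Qed.

Lemma mx_apply_shear (R : realType) n w b (x : Rn R n) (i : 'I_n) :
  let X := zero_ext R n (tnth x) in
  tnth (mx_apply (shear_mx R n w b) x) i =
    if odd i then b i./2 / 2 * X i.-1 + w * X i else X i / 2.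
Proof.
move=> X; rewrite tnth_mktuple.
under eq_bigr => j _ do rewrite mxE -[tnth x j](zero_ext_ord _ _ (tnth x)) -/X.
have X0 k : (n <= k)%N -> X k = 0 by exact: zero_ext_out.
case: ifPn => oi.
  rewrite -(sum_ord_delta R n X i (@X0 _)) -(sum_ord_delta R n X i.-1 (@X0 _)).
  rewrite !mulr_sumr -big_split; apply: eq_bigr => j _ /=.
  rewrite -(eqSS i.-1) prednK ?odd_gt0// eq_sym [(i : nat) == j]eq_sym val_eqE.
  by ring.
rewrite -(sum_ord_delta R n X i (@X0 _)) mulr_suml; apply: eq_bigr => j _ /=.
by rewrite eq_sym val_eqE; ring.
Qed.

Lemma quad_form_mulmx_tr (R : realType) n (A : 'M[R]_n) (c : R) (u : 'rV[R]_n) :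
  (u *m (A *m A^T - c%:M) *m u^T) 0 0 =
  \sum_j (u *m A) 0 j ^+ 2 - c * \sum_j u 0 j ^+ 2.
Proof.
rewrite mulmxBr mulmxBl mulmxA -mulmxA -trmx_mul mul_mx_scalar -scalemxAl.
rewrite [LHS]mxE; congr (_ + _); first by rewrite mxE; apply: eq_bigr => j _; rewrite [_^T _ _]mxE.
by rewrite !mxE; congr (- (_ * _)); apply: eq_bigr => j _; rewrite [_^T _ _]mxE.
Qed.

(** Decoupling into planar blocks reduces both Loewner bounds to inequalities in two reals, with [c]
    equal to [kappa^-1] for the lower one and to 1 for the upper one. *)
Lemma shear_mx_quad_form (R : realType) n w b (u : 'rV[R]_n) c :
  let U := zero_ext R n (u 0) in
  \sum_j (u *m shear_mx R n w b) 0 j ^+ 2 - c * \sum_j u 0 j ^+ 2 =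
  \sum_(l < n) (((U l.*2 + b l * U l.*2.+1) / 2) ^+ 2 + (w * U l.*2.+1) ^+ 2
   - c * (U l.*2 ^+ 2 + U l.*2.+1 ^+ 2)).
Proof.
move=> U; rewrite sumrB -mulr_sumr; congr (_ - _ * _).
  pose V k := if odd k then w * U k else (U k + b k./2 * U k.+1) / 2.
  under eq_bigr => j _ do rewrite mul_shear_mx -/U -[if _ then _ else _]/(V j).
  rewrite (sum_ord_pairs R n (fun k => V k ^+ 2)); last first.
    move=> k nk; rewrite /V /U !zero_ext_out ?(leqW nk)//.
    by case: ifP => _; rewrite ?mulr0 ?addr0 ?mul0r expr0n.
  by apply: eq_bigr => l _; rewrite /V /= odd_double doubleK.
under eq_bigr => j _ do rewrite -[u 0 j](zero_ext_ord _ _ (u 0)) -/U.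
rewrite (sum_ord_pairs R n (fun k => U k ^+ 2))// => k nk.
by rewrite /U zero_ext_out// expr0n.
Qed.

Lemma shear_mx_loewner (R : realType) n (kappa w : R) b :
  16 <= kappa -> w ^+ 2 = 4 / kappa -> (forall l, 0 <= b l <= 1) ->
  let A := shear_mx R n w b in
  loewner_le (kappa^-1)%:M (A *m A^T) /\ loewner_le (A *m A^T) 1%:M.
Proof.
move=> k16 w2 b01 A.
have k0 : 0 < kappa^-1 by rewrite invr_gt0; lra.
have k1 : kappa^-1 <= 16^-1 by rewrite lef_pV2// posrE; lra.
have sym : (A *m A^T)^T = A *m A^T by rewrite trmx_mul trmxK.
split; split; rewrite ?linearB/= ?sym ?tr_scalar_mx// => u.
  rewrite quad_form_mulmx_tr shear_mx_quad_form; apply: sumr_ge0 => l _.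
  move: (zero_ext _ _ _ _) (zero_ext _ _ _ _) => y x.
  rewrite [(w * _) ^+ 2]exprMn w2; move: (b01 l) k0 k1.
  move: (b l) (kappa^-1) => d c /andP[d0 d1] c0 c1.
  (* A combination of squares whose weights are nonnegative because [c <= 1/16] and [0 <= d <= 1];
     the term [4 * c] is [w ^+ 2]. *)
  have -> : ((x + d * y) / 2) ^+ 2 + 4 * c * y ^+ 2 - c * (x ^+ 2 + y ^+ 2) =
    (1 / 4 - 2 * c) * (x + d * y) ^+ 2 + c * (3 - 2 * d ^+ 2) * y ^+ 2
    + c * (x + 2 * d * y) ^+ 2 by field.
  have d2 : d ^+ 2 <= 1 by rewrite expr_le1.
  have h1 : 0 <= 1 / 4 - 2 * c by lra.
  have h2 : 0 <= c * (3 - 2 * d ^+ 2) by rewrite mulr_ge0 ?(ltW c0)//; lra.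
  by do 2?[apply: addr_ge0]; rewrite mulr_ge0 ?sqr_ge0// ltW.
rewrite -opprB mulmxN mulNmx mxE quad_form_mulmx_tr shear_mx_quad_form -sumrN.
apply: sumr_ge0 => l _.
move: (zero_ext _ _ _ _) (zero_ext _ _ _ _) => y x.
rewrite [(w * _) ^+ 2]exprMn w2; move: (b01 l) k0 k1.
move: (b l) (kappa^-1) => d c /andP[d0 d1] c0 c1.
have -> : - (((x + d * y) / 2) ^+ 2 + 4 * c * y ^+ 2 - 1 * (x ^+ 2 + y ^+ 2)) =
  1 / 2 * x ^+ 2 + (1 - d ^+ 2 / 2 - 4 * c) * y ^+ 2 + 1 / 4 * (x - d * y) ^+ 2.
  by field.
have d2 : d ^+ 2 <= 1 by rewrite expr_le1.
have h : 0 <= 1 - d ^+ 2 / 2 - 4 * c by lra.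
by do 2?[apply: addr_ge0]; rewrite mulr_ge0 ?sqr_ge0// divr_ge0.
Qed.

Lemma measurable_mx_apply (R : realType) n (A : 'M[R]_n) :
  measurable_fun [set: Rn R n] (mx_apply A).
Proof.
apply/measurable_fun_tnthP => i; rewrite /mx_apply.
have -> : (tnth (T:=measurableTypeR R))^~ i \o
   (fun x => [tuple \sum_(j < n) A i j * tnth x j | i < n]) =
   (fun x => \sum_(j < n) A i j * tnth x j).
  by apply/funext => x /=; rewrite tnth_mktuple.
apply: measurable_sum => j; apply: measurable_funM => //.
exact: measurable_tnth.
Qed.

HB.instance Definition _ (R : realType) (n : nat) (A : 'M[R]_n) :=
  isMeasurableFun.Build _ _ _ _ (mx_apply A) (measurable_mx_apply R n A).

Definition gaussian_mx (R : realType) n (A : 'M[R]_n) : probability (Rn R n) R :=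
  distribution (std_gaussian R n) (mx_apply A).
Lemma gaussian_mxP (R : realType) n (A : 'M[R]_n) :
  is_gaussian (A *m A^T) (gaussian_mx R n A).
Proof. by exists A. Qed.

(** * Counting bound for finite-bit samplers *)

Lemma agreeing_functions_count (I J : finType) (q : nat) (P : I -> J -> bool) :
  (0 < q)%N -> #|J| = (q ^ 2)%N ->
  (forall i j j', P i j -> P i j' -> j = j') ->
  (#|[pred f : {ffun I -> J} | (#|I| <= 2 * #|[pred i | P i (f i)]|)%N]|
     <= (2 * q) ^ #|I|)%N.
Proof.
(* Weighing f by #|J| to the number of its agreements gives at least q ^ #|I| on
   the functions counted here, and a total that factorizes over I. *)
move=> q0 cJ Puniq.
(* At most one [j] has weight [#|J|]; the others weigh at most [#|J|] together. *)
have Ubound i : (\sum_j (if P i j then #|J| else 1) <= 2 * #|J|)%N.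
  have [[j Pij]|noP] := pselect (exists j, P i j).
    rewrite (bigD1 j)//= Pij mul2n -addnn leq_add2l -sum1_card.
    rewrite [leqRHS](bigD1 j)//= -[leqLHS]add0n leq_add//.
    apply: leq_sum => j' j'j; case: ifP => // /Puniq-/(_ _ Pij) jj'.
    by rewrite jj' eqxx in j'j.
  rewrite -[X in (_ <= 2 * X)%N]sum1_card mul2n -addnn -[leqLHS]add0n leq_add//.
  by apply: leq_sum => j _; case: ifP => // Pij; case: noP; exists j.
have : (\sum_(f : {ffun I -> J}) #|J| ^ #|[pred i | P i (f i)]|
        <= (2 * #|J|) ^ #|I|)%N.
  rewrite -prod_nat_const.
  apply: (@leq_trans (\prod_i \sum_j (if P i j then #|J| else 1))); last first.
    by apply: leq_prod => i _; exact: Ubound.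
  rewrite bigA_distr_bigA/=; apply: leq_sum => f _.
  rewrite -big_mkcond /= prod_nat_const leq_eqVlt; apply/orP; left.
  by apply/eqP; congr (_ ^ _)%N; apply: eq_card => i; rewrite !inE.
set B := [pred f | _] => sumle.
(* The extra factor turns the right-hand side into [(2 * #|J|) ^ #|I|], as [#|J| = q ^ 2]. *)
rewrite -(@leq_pmul2l (q ^ #|I|)) ?expn_gt0 ?q0// -expnMn mulnCA.
rewrite -[(q * q)%N]/(q ^ 2)%N -cJ (leq_trans _ sumle)//.
apply: (@leq_trans (\sum_(f in B) #|J| ^ #|[pred i | P i (f i)]|)); last first.
  by rewrite [leqRHS](bigID (mem B))/= leq_addr.
rewrite mulnC -sum_nat_const; apply: leq_sum => f; rewrite inE => fB.
by rewrite cJ -expnM leq_pexp2l.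
Qed.

Lemma sampler_packing_bound (R : realType) n (C : set (probability (Rn R n) R))
    (Q delta eta L : R) (S : finite_bit_sampler C Q) (I : finType)
    (pi : I -> probability (Rn R n) R) (A : I -> set (Rn R n)) :
  (ereal_sup [set tv_dist (output_law S pi) pi | pi in C] <= delta%:E)%E ->
  (forall i, C (pi i)) -> (forall i, measurable (A i)) ->
  (forall i, (eta%:E <= pi i (A i))%E) ->
  (forall y, \sum_i \1_(A i) y <= L) -> 0 <= L ->
  #|I|%:R * (eta - delta) <= 2 `^ Q * L.
Proof.
move=> tv Cpi mA piA overlap L0.
pose out i z := reconstruct S (transcript S (pi i) z) z.
have mout i : measurable (out i @^-1` A i).
  (* Measurability is known message by message, so the event is split into finitely many pieces. *)
  have -> : out i @^-1` A i = \bigcup_(t in [set: message S])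
      ([set z | transcript S (pi i) z = t] `&` reconstruct S t @^-1` A i).
    apply/seteqP; split => [z Az|z [t _ [/= <-]//]].
    by exists (transcript S (pi i) z).
  apply: fin_bigcup_measurable => [|t _]; first exact: finite_finset.
  apply: measurableI; first exact: measurable_transcript.
  by rewrite -[X in measurable X]setTI; apply: measurable_reconstruct.
have lawA i : ((eta - delta)%:E <= seed_law S (out i @^-1` A i))%E.
  have tvi : (`|output_law S (pi i) (A i) - pi i (A i)| <= delta%:E)%E.
    apply: le_trans tv; apply: (@le_trans _ _ (tv_dist (output_law S (pi i)) (pi i))).
      by apply: ereal_sup_ubound; exists (A i).
    by apply: ereal_sup_ubound; exists (pi i).
  have oE : output_law S (pi i) (A i) = seed_law S (out i @^-1` A i) by [].
  rewrite {}oE in tvi.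
  move: (piA i) tvi (fin_num_measure (pi i) (A i) (mA i))
    (fin_num_measure (seed_law S) _ (mout i)).
  case: (pi i (A i)) => // a; case: (seed_law S _) => // b.
  rewrite -EFinB abse_EFin !lee_fin => ea + _ _.
  rewrite ler_norml => /andP[+ _]; lra.
have bound : (\sum_i seed_law S (out i @^-1` A i) <= (#|message S|%:R * L)%:E)%E.
  apply: sum_probability_le => // z.
  (* The transcript depends on [i], so its term is bounded by the sum over all messages; after
     exchanging the sums, each message contributes at most [L]. *)
  apply: (@le_trans _ _ (\sum_i \sum_t \1_(A i) (reconstruct S t z))).
    apply: ler_sum => i _; rewrite (bigD1 (transcript S (pi i) z))//=.
    by rewrite lerDl sumr_ge0.
  rewrite exchange_big/= mulr_natl -sumr_const.
  by apply: ler_sum => t _; exact: overlap.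
apply: (@le_trans _ _ (#|message S|%:R * L)); last first.
  by rewrite ler_wpM2r// card_message.
rewrite -lee_fin; apply: le_trans bound.
rewrite mulr_natl -sumr_const -sumEFin; apply: lee_sum => i _; exact: lawA.
Qed.

(** * Cones around lines of prescribed slope *)

Lemma odd_coord_lt n (l : 'I_(n./2)) : (l.*2.+1 < n)%N.
Proof.
rewrite -[X in (_ < X)%N](odd_double_half n) (@leq_trans (n./2).*2) ?leq_addl//.
by rewrite -doubleS leq_double.
Qed.

Definition even_coord n (l : 'I_(n./2)) : 'I_n := Ordinal (ltnW (odd_coord_lt n l)).
Definition odd_coord n (l : 'I_(n./2)) : 'I_n := Ordinal (odd_coord_lt n l).

(** The tolerance is half the spacing [1 / K] of the slopes, and the strict inequality excludes a
    zero even coordinate; this makes the cones disjoint. *)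
Definition cone (R : realType) n (K : nat) (l : 'I_(n./2)) (k : nat) : set (Rn R n) :=
  [set y | `|tnth y (odd_coord n l) - k%:R / K%:R * tnth y (even_coord n l)|
           < `|tnth y (even_coord n l)| / (2 * K%:R)].

Lemma measurable_cone (R : realType) n K l k : measurable (cone R n K l k).
Proof.
rewrite -[cone _ _ _ _ _]setTI.
have m := @measurable_fun_ltr _ (Rn R n) R setT
  (fun y => `|tnth y (odd_coord n l) - k%:R / K%:R * tnth y (even_coord n l)|)
  (fun y => `|tnth y (even_coord n l)| / (2 * K%:R)).
apply: m => //.
- apply: measurableT_comp => //; apply: measurable_funB; first exact: measurable_tnth.
  by apply: measurable_funM => //; exact: measurable_tnth.
- by apply: measurable_funM => //; apply: measurableT_comp => //; exact: measurable_tnth.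
Qed.

Lemma cone_disjoint (R : realType) n K l (k k' : nat) y :
  (0 < K)%N -> cone R n K l k y -> cone R n K l k' y -> k = k'.
Proof.
move=> K0; rewrite /cone/=; set v := tnth y _; set u := tnth y _ => h h'.
have K0' : 0 < K%:R :> R by rewrite ltr0n.
have u0 : 0 < `|u|.
  have := le_lt_trans (normr_ge0 _) h.
  by rewrite pmulr_lgt0// invr_gt0 mulr_gt0.
have : `|k%:R - k'%:R| * `|u| < 1 * `|u| :> R.
  rewrite -normrM mul1r.
  have -> : (k%:R - k'%:R) * u =
     ((v - k'%:R / K%:R * u) - (v - k%:R / K%:R * u)) * K%:R.
    by field; rewrite gt_eqF.
  rewrite normrM [`|K%:R|]ger0_norm// -ltr_pdivlMr//.
  apply: (le_lt_trans (ler_normB _ _)).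
  have -> : `|u| / K%:R = `|u| / (2 * K%:R) + `|u| / (2 * K%:R).
    by field; rewrite gt_eqF.
  exact: ltrD.
rewrite ltr_pM2r//.
(* Distinct naturals are at distance at least 1. *)
by have [kk|kk|//] := ltngtP k k';
  [rewrite distrC -natrB ?(ltnW kk)// normr_nat -[1]/(1%:R) ltr_nat; lia
  |rewrite -natrB ?(ltnW kk)// normr_nat -[1]/(1%:R) ltr_nat; lia].
Qed.

(** With [r] the square root of [kappa], a block [(u, v)] is sent at vertical distance [2 * |v| / r]
    from its line, while the cone tolerates [|u| / (4 * K)]. Hence [|v| < s * |u|] suffices when
    [s <= r / (8 * K)]. *)
Lemma shear_mem_cone (R : realType) n (kappa s : R) (K : nat) (b : nat -> R)
    (l : 'I_(n./2)) (k : nat) (x : Rn R n) :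
  0 < kappa -> (0 < K)%N -> 8 * s * K%:R <= Num.sqrt kappa ->
  b l = k%:R / K%:R ->
  ~ steep R s (tnth x (even_coord n l), tnth x (odd_coord n l)) ->
  cone R n K l k (mx_apply (shear_mx R n (2 / Num.sqrt kappa) b) x).
Proof.
move=> k0 K0 sK bl; rewrite /steep /cone /= => /negP; rewrite -ltNge.
have K0' : 0 < K%:R :> R by rewrite ltr0n.
have r0 : 0 < Num.sqrt kappa by rewrite sqrtr_gt0.
rewrite !mx_apply_shear /= odd_double /= uphalf_double.
rewrite -[l.*2]/(val (even_coord n l)) -[l.*2.+1]/(val (odd_coord n l)).
rewrite !zero_ext_ord bl.
move: (tnth _ _) (tnth _ _) => u v uv.
set r := Num.sqrt _ in sK r0 *.
have -> : k%:R / K%:R / 2 * u + 2 / r * v - k%:R / K%:R * (u / 2) = 2 / r * v by ring.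
rewrite normrM [`|2 / r|]ger0_norm ?divr_ge0 ?ltW// normrM [`|2^-1|]ger0_norm//.
have -> : `|u| / 2 / (2 * K%:R) = 2 / r * (r / (8 * K%:R) * `|u|).
  by field; rewrite !gt_eqF.
rewrite ltr_pM2l ?divr_gt0//; apply: lt_le_trans uv _.
by rewrite ler_wpM2r// ler_pdivlMr ?mulr_gt0// mulrCA mulrA.
Qed.

(** * Target Gaussians and their majority sets *)

Definition majority_set (R : realType) n (K : nat) (f : {ffun 'I_(n./2) -> 'I_K}) :
    set (Rn R n) :=
  [set y | (n./2)%:R <= 2 * \sum_l \1_(cone R n K l (f l)) y :> R].

Lemma measurable_majority_set (R : realType) n K f : measurable (majority_set R n K f).
Proof.
rewrite -[majority_set _ _ _ _]setTI.
have m := @measurable_fun_ler _ (Rn R n) R setT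
  (cst (n./2)%:R) (fun y => 2 * \sum_l \1_(cone R n K l (f l)) y).
apply: m => //; apply: measurable_funM => //.
by apply: measurable_sum => l; apply: measurable_indic; exact: measurable_cone.
Qed.

(** By disjointness of the cones, [y] prescribes at most one slope per block, and [f] must agree
    with it on half of the blocks. *)
Lemma majority_set_overlap (R : realType) n q (y : Rn R n) : (0 < q)%N ->
  \sum_f \1_(majority_set R n (q ^ 2) f) y <= ((2 * q) ^ n./2)%:R :> R.
Proof.
move=> q0.
have h := @agreeing_functions_count 'I_(n./2) 'I_(q ^ 2) q
  (fun l k => y \in cone R n (q ^ 2) l k) q0 (card_ord _).
under eq_bigr do rewrite indicE.
rewrite -natr_sum ler_nat; move: h; rewrite card_ord => h.
apply: leq_trans (h _); last first.
  by move=> l k k' /set_mem hk /set_mem /(cone_disjoint _ _ _ _ _ _ _ _ hk) kk';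
    apply: val_inj; apply: kk'; rewrite expn_gt0 q0.
rewrite -sum1_card [leqRHS]big_mkcond /=; apply: leq_sum => f _.
case: (boolP (y \in _)) => // /set_mem; rewrite /majority_set /=.
under eq_bigr do rewrite indicE.
rewrite -natr_sum -natrM ler_nat => h'.
rewrite ifT// inE; apply: leq_trans h' _; rewrite leq_mul2l -sum1_card /=.
by rewrite [leqRHS]big_mkcond /= leq_sum// => l _; rewrite inE; case: (y \in _).
Qed.

(** The default slope 0 stays within the range [[0, 1]] that the Loewner bounds require. *)
Definition shear_gaussian (R : realType) n (kappa : R) (K : nat)
    (f : {ffun 'I_(n./2) -> 'I_K}) : probability (Rn R n) R :=
  gaussian_mx R n (shear_mx R n (2 / Num.sqrt kappa)
    (fun l => oapp (fun l' => (f l')%:R / K%:R) 0 (insub l))).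

Lemma shear_gaussian_class (R : realType) n (kappa : R) K f :
  16 <= kappa -> gaussian_class kappa (shear_gaussian R n kappa K f).
Proof.
move=> k16; set A := shear_mx R n (2 / Num.sqrt kappa)
    (fun l => oapp (fun l' => (f l')%:R / K%:R) 0 (insub l)).
exists (A *m A^T).
have k0 : 0 < kappa by lra.
have [|//|] := shear_mx_loewner R n kappa (2 / Num.sqrt kappa)
   (fun l => oapp (fun l' => (f l')%:R / K%:R) 0 (insub l)) k16.
- by rewrite expr_div_n sqr_sqrtr ?ltW// -natrX.
- move=> l; case: insubP => /= [l' _ _|_]; last by rewrite lexx ler01.
  rewrite divr_ge0//= ler_pdivrMr ?mul1r ?ler_nat ?ltr0n.
    exact: ltnW.
  exact: leq_trans (ltn_ord (f l')).
by move=> ? ?; split=> //; exact: gaussian_mxP.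
Qed.

Lemma shear_gaussian_majority (R : realType) n (kappa s e : R) K f :
  (2 <= n)%N -> 0 < kappa -> (0 < K)%N -> 8 * s * K%:R <= Num.sqrt kappa ->
  ((gauss R \x gauss R) (steep R s) <= e%:E)%E ->
  ((1 - 2 * e)%:E <= shear_gaussian R n kappa K f (majority_set R n K f))%E.
Proof.
move=> n2 k0 K0 sK steepe; set P := shear_gaussian _ _ _ _ _; set A := majority_set _ _ _ _.
have mA : measurable A by exact: measurable_majority_set.
set b := fun l => oapp (fun l' => (f l')%:R / K%:R) 0 (insub l) : R.
pose T := mx_apply (shear_mx R n (2 / Num.sqrt kappa) b).
have m0 : (0 < n./2)%N by rewrite half_gt0.
pose E l := [set x : Rn R n | steep R s (tnth x (even_coord n l), tnth x (odd_coord n l))].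
have mE l : measurable (E l).
  rewrite -[E l]setTI.
  exact: (measurable_tnth_pair _ _ _ _ measurableT _ (measurable_steep R s)).
have mB : measurable (T @^-1` (~` A)).
  rewrite -[X in measurable X]setTI; apply: measurable_mx_apply => //.
  exact: measurableC.
have markov : (((n./2)%:R / 2)%:E * std_gaussian R n (T @^-1` (~` A))
    <= \sum_l std_gaussian R n (E l))%E.
  apply: markov_sum_indic => // x /= /negP; rewrite -ltNge => hA.
  (* Outside [A] more than half of the blocks miss their cone, and each of these is steep. *)
  apply: (@le_trans _ _ (\sum_l (1 - \1_(cone R n K l (f l)) (T x)))).
    by rewrite sumrB sumr_const card_ord; move: hA; set S := \sum_l _ ; set m := _%:R; lra.
  apply: ler_sum => l _; rewrite !indicE.
  case: (boolP (x \in E l)) => [_|/negP xE]; first by rewrite lerBlDr lerDl ler0n.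
  rewrite subr_le0 mem_set//; apply: (shear_mem_cone _ _ _ s) => //.
    by rewrite /b valK.
  by move=> xs; apply: xE; rewrite inE.
have PC : (P (~` A) <= (2 * e)%:E)%E.
  have : (((n./2)%:R / 2)%:E * P (~` A) <= ((n./2)%:R * e)%:E)%E.
    apply: le_trans markov _; rewrite mulr_natl.
    have -> : (e *+ n./2)%:E = (\sum_(l < n./2) e%:E)%E.
      by rewrite sumEFin sumr_const card_ord.
    apply: lee_sum => l _; apply: le_trans steepe; rewrite le_eqVlt; apply/orP; left.
    by apply/eqP; apply: std_gaussian_marginal_pair => //; exact: measurable_steep.
  move=> h; rewrite -(@lee_pmul2l _ ((n./2)%:R / 2)%:E)//; last by rewrite lte_fin divr_gt0// ltr0n.
  by rewrite -EFinM [(_ / 2 * _)%R](_ : _ = (n./2)%:R * e)//; field.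
have := probability_setC P (measurableC mA); rewrite setCK => ->.
by rewrite EFinB leeB.
Qed.

(** * Choice of parameters and the bit bound *)

Lemma growth_of_bit_bound (R : realType) (D h B : R) (q m : nat) :
  1 <= D -> 1 <= h -> 2 * D * h <= q%:R -> (0 < m)%N ->
  ((q ^ 2) ^ m)%:R * D^-1 <= B * ((2 * q) ^ m)%:R -> h ^+ m <= B.
Proof.
move=> D1 h1 qD m0.
have D0 : 0 < D by lra.
have q0 : 0 < q%:R :> R by apply: lt_le_trans qD; rewrite !mulr_gt0//; lra.
rewrite !natrX natrM expr2 !exprMn.
set x := q%:R ^+ m; have x0 : 0 < x by rewrite exprn_gt0.
rewrite mulrAC mulrA ler_pM2r// => xB.
(* Since [1 <= D] and [0 < m], [D <= D ^+ m]. *)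
have : 2 ^+ m * D * h ^+ m <= x.
  apply: (@le_trans _ _ ((2 * D * h) ^+ m)).
    rewrite 2!exprMn ler_pM2r ?exprn_gt0//; last lra.
    by rewrite ler_pM2l ?exprn_gt0// -[leLHS]expr1 ler_weXn2l.
  by rewrite lerXn2r// nnegrE ?ltW// !mulr_gt0//; lra.
rewrite -mulrA mulrCA -ler_pdivlMl// mulrC [D^-1 * x]mulrC => /le_trans/(_ xB).
by rewrite ler_pM2r// exprn_gt0.
Qed.

Lemma leq_triple_half (n : nat) : (2 <= n)%N -> (n <= 3 * n./2)%N.
Proof. lia. Qed.

Theorem theorem6 (R : realType) (delta : R) (hdelta : 0 <= delta < 1) :
  exists c kappa0 : R, 0 < c /\
    forall (n : nat) (kappa : R), (2 <= n)%N -> kappa0 <= kappa ->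
    forall (Q : R) (S : finite_bit_sampler (@gaussian_class R n kappa) Q),
      (ereal_sup [set tv_dist (output_law S pi) pi
                 | pi in @gaussian_class R n kappa] <= delta%:E)%E ->
      c * n%:R * (ln kappa / ln 2) <= Q.
Proof.
move: hdelta => /andP[d0 d1].
(* The majority sets then have mass at least [1 - (1 - delta) / 2], which exceeds [delta] by
   [(1 - delta) / 2], the inverse of [D] below. *)
have [|s s1 steepe] := @gaussian_steep_small R ((1 - delta) / 4).
  by rewrite divr_gt0// subr_gt0.
pose D := 2 / (1 - delta).
have D1 : 1 <= D by rewrite ler_pdivlMr ?subr_gt0//; lra.
(* Chosen so that [q <= 4 * D * h] yields [8 * s * q ^+ 2 <= M * h ^+ 2]. *)
pose M := 32 * s * (2 * D) ^+ 2.
have D0 : 0 < D by exact: lt_le_trans D1.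
have s0 : 0 < s by exact: lt_le_trans s1.
have M0 : 0 < M by apply: mulr_gt0; [apply: mulr_gt0|apply: exprn_gt0; apply: mulr_gt0].
(* The factor 24 is 8 from [h = kappa ^ (1/8)] times 3 from [n <= 3 * n./2]. The 16 serves the
   Loewner bounds, and [M ^+ 4 <= kappa = h ^+ 8] gives [M <= h ^+ 2]. *)
exists 24^-1, (16 + M ^+ 4); split => // n kappa n2 kappa0 Q S tv.
have k16 : 16 <= kappa by have := exprn_gt0 4 M0; lra.
have k0 : 0 < kappa by lra.
pose h := kappa `^ 8^-1.
have h8 : h ^+ 8 = kappa.
  by rewrite -powR_mulrn ?powR_ge0// -powRrM mulVf ?powRr1// ltW.
have h0 : 0 <= h by exact: powR_ge0.
have h1 : 1 <= h by rewrite -(@expr_ge1 _ 8)// h8; lra.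
have sqrt_kappa : Num.sqrt kappa = h ^+ 4.
  by rewrite -h8 (exprM h 4 2) sqrtr_sqr ger0_norm// exprn_ge0.
have hp : 0 < h by exact: lt_le_trans h1.
have hM : M <= h ^+ 2.
  rewrite -(@ler_pXn2r _ 4)// ?nnegrE ?exprn_ge0 ?ltW//.
  by rewrite -exprM h8; lra.
(* An integer between [2 * D * h], needed for growth, and twice that, needed for the cones to be
   wide enough. *)
pose q := (Num.trunc (2 * D * h)).+1.
have Dh : 1 <= 2 * D * h by nra.
have qlt : 2 * D * h < q%:R by exact: truncnS_gt.
have qle : q%:R <= 2 * (2 * D * h).
  rewrite /q -natr1; have /andP[+ _] := truncn_itv (le_trans ler01 Dh).
  lra.
have sq : 8 * s * (q ^ 2)%:R <= Num.sqrt kappa.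
  rewrite sqrt_kappa (exprM h 2 2) natrX.
  apply: (@le_trans _ _ (8 * s * (2 * (2 * D * h)) ^+ 2)).
    rewrite ler_pM2l ?mulr_gt0//.
    by rewrite lerXn2r// nnegrE ?ler0n//; lra.
  have -> : 8 * s * (2 * (2 * D * h)) ^+ 2 = M * h ^+ 2 by rewrite /M; ring.
  by rewrite -[leRHS]/(h ^+ 2 * h ^+ 2) ler_wpM2r ?exprn_ge0.
have m0 : (0 < n./2)%N by rewrite half_gt0.
have hB : h ^+ n./2 <= 2 `^ Q.
  apply: (@growth_of_bit_bound _ D h _ q) => //; first exact: ltW.
  have := @sampler_packing_bound R n _ Q delta (1 - 2 * ((1 - delta) / 4))
    ((2 * q) ^ n./2)%:R S {ffun 'I_(n./2) -> 'I_(q ^ 2)}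
    (shear_gaussian R n kappa (q ^ 2)) (majority_set R n (q ^ 2)) tv.
  rewrite card_ffun !card_ord.
  have -> : 1 - 2 * ((1 - delta) / 4) - delta = D^-1 by rewrite invf_div; field.
  apply => //.
  - by move=> f; exact: shear_gaussian_class.
  - by move=> f; exact: measurable_majority_set.
  - by move=> f; apply: (shear_gaussian_majority _ _ _ s).
  - by move=> y; exact: majority_set_overlap.
have ln2 : 0 < ln 2 :> R by rewrite ln_gt0// ltr1n.
have lnk : 0 <= ln kappa by rewrite ln_ge0//; lra.
rewrite mulrA ler_pdivrMr//.
(* Taking logarithms in [hB] bounds [n./2 * ln kappa / 8] by [Q * ln 2]. *)
apply: (@le_trans _ _ (ln (h ^+ n./2))); last first.
  by rewrite -ln_powR ler_ln// posrE ?powR_gt0// exprn_gt0// powR_gt0.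
have lnh : ln h = 8^-1 * ln kappa by rewrite ln_powR.
rewrite lnXn// lnh -[leRHS]mulr_natl [leRHS]mulrA; apply: ler_wpM2r => //.
have := leq_triple_half n n2; rewrite -(ler_nat R) natrM; move: (n%:R) (n./2%:R) => x y; lra.
Qed.
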